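(* For coefficients $\alpha>0$ and $\beta>0$ let $$B_{11}(\alpha)=H_1J_1g_1^{11}-\alpha P_{c1}^T\hat H\hat J\hat g^{11}P_{c1},\qquad B_{22}(\beta)=H_2J_2g_2^{22}-\beta P_{c2}^T\hat H\hat J\hat g^{22}P_{c2}.$$ Let $\max\lambda^{(1)}$ and $\max\lambda^{(2)}$ be the largest eigenvalues of the respective generalized eigenvalue problems $$\mathbb{Y}^{(1)}\boldsymbol{y}=\lambda^{(1)}\mathbb{X}^{(1)}\boldsymbol{y},\quad \mathbb{Y}^{(1)}=P_{c1}^T\hat H\hat J\hat g^{11}P_{c1},\quad \mathbb{X}^{(1)}=H_1J_1g_1^{11},$$ $$\mathbb{Y}^{(2)}\boldsymbol{y}=\lambda^{(2)}\mathbb{X}^{(2)}\boldsymbol{y},\quad \mathbb{Y}^{(2)}=P_{c2}^T\hat H\hat J\hat g^{22}P_{c2},\quad \mathbb{X}^{(2)}=H_2J_2g_2^{22}.$$ If $$\alpha\le\widetilde\alpha=\frac{1}{\max\lambda^{(1)}}\quad\text{and}\quad\beta\le\widetilde\beta=\frac{1}{\max\lambda^{(2)}},$$ then the matrices $B_{11}(\alpha)$ and $B_{22}(\beta)$ are positive semi-definite.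
   Context: Let $N\ge1$ be an integer, $\hat N=(N+2)(N+2)$, $N_1=(N+1)(N+2)$, $N_2=(N+2)(N+1)$, and let $\hat I$ be the $(N+2)\times(N+2)$ identity matrix. $M\in\mathbb{R}^{(N+1)\times(N+1)}$ and $\hat M\in\mathbb{R}^{(N+2)\times(N+2)}$ are positive definite diagonal matrices, and $P\in\mathbb{R}^{(N+1)\times(N+2)}$, $\hat P\in\mathbb{R}^{(N+2)\times(N+1)}$ are staggered SBP interpolation operators: $MP=\hat P^T\hat M$, and constants are interpolated exactly (in particular $\hat P$ maps the all-ones vector to the all-ones vector, and so does $P$). Set $$H_1=M\otimes\hat M,\quad H_2=\hat M\otimes M,\quad \hat H=\hat M\otimes\hat M,\quad P_{c1}=\hat P\otimes\hat I\in\mathbb{R}^{\hat N\times N_1},\quad P_{c2}=\hat I\otimes\hat P\in\mathbb{R}^{\hat N\times N_2}.$$ $J_1,g_1^{11}\in\mathbb{R}^{N_1\times N_1}$, $J_2,g_2^{22}\in\mathbb{R}^{N_2\times N_2}$ and $\hat J,\hat g^{11},\hat g^{22}\in\mathbb{R}^{\hat N\times\hat N}$ are diagonal matrices with positive diagonal entries: the Jacobian of the curvilinear mapping and the diagonal components of the (symmetric positive definite) contravariant metric tensor, evaluated on the edge-1 grid, the edge-2 grid, and the cell-centered grid, respectively. *)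

(* Defs.v *)
From mathcomp Require Import all_boot all_order all_algebra.
From mathcomp.real_closed Require Import mxtens.
From mathcomp Require Import reals.

Set Implicit Arguments.
Unset Strict Implicit.
Unset Printing Implicit Defensive.

Import Order.TTheory GRing.Theory Num.Theory.
Local Open Scope ring_scope.

Section Matrices.
Context {R : realType}.

Definition posdefmx n (A : 'M[R]_n) : Prop :=
  A^T = A /\ forall x : 'cV[R]_n, x != 0 -> 0 < (x^T *m A *m x) 0 0.

Definition possemidefmx n (A : 'M[R]_n) : Prop :=
  A^T = A /\ forall x : 'cV[R]_n, 0 <= (x^T *m A *m x) 0 0.

Definition pos_diag_mx n (D : 'M[R]_n) : Prop :=
  is_diag_mx D /\ forall i, 0 < D i i.

Definition gen_eigenvalue n (Y X : 'M[R]_n) (l : R) : Prop :=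
  exists2 y : 'cV[R]_n, y != 0 & Y *m y = l *: (X *m y).

(* Only real eigenvalues are considered; when Y is symmetric and X is positive
   definite the pencil (Y, X) has no others. *)
Definition max_gen_eigenvalue n (Y X : 'M[R]_n) (l : R) : Prop :=
  gen_eigenvalue Y X l /\ forall m, gen_eigenvalue Y X m -> m <= l.

(* M and P act on, resp. map to, the (N+1)-point grid; Mhat and Phat the
   (N+2)-point grid.  [const_mx 1] is the all-ones vector. *)
Definition staggered_sbp N (M : 'M[R]_(N.+1)) (Mhat : 'M[R]_(N.+2))
    (P : 'M[R]_(N.+1, N.+2)) (Phat : 'M[R]_(N.+2, N.+1)) : Prop :=
  [/\ is_diag_mx M /\ posdefmx M, is_diag_mx Mhat /\ posdefmx Mhat,
      M *m P = Phat^T *m Mhat,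
      P *m (const_mx 1 : 'cV[R]_(N.+2)) = const_mx 1
    & Phat *m (const_mx 1 : 'cV[R]_(N.+1)) = const_mx 1].

Section Grid.
Context {N : nat} (M : 'M[R]_(N.+1)) (Mhat : 'M[R]_(N.+2))
  (Phat : 'M[R]_(N.+2, N.+1)).

Definition H1 : 'M[R]_(N.+1 * N.+2) := M *t Mhat.
Definition H2 : 'M[R]_(N.+2 * N.+1) := Mhat *t M.
Definition Hhat : 'M[R]_(N.+2 * N.+2) := Mhat *t Mhat.
Definition Pc1 : 'M[R]_(N.+2 * N.+2, N.+1 * N.+2) :=
  Phat *t (1%:M : 'M[R]_(N.+2)).
Definition Pc2 : 'M[R]_(N.+2 * N.+2, N.+2 * N.+1) :=
  (1%:M : 'M[R]_(N.+2)) *t Phat.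

Definition X1 (J1 g1 : 'M[R]_(N.+1 * N.+2)) := H1 *m J1 *m g1.
Definition X2 (J2 g2 : 'M[R]_(N.+2 * N.+1)) := H2 *m J2 *m g2.
Definition Y1 (Jhat ghat : 'M[R]_(N.+2 * N.+2)) :=
  Pc1^T *m Hhat *m Jhat *m ghat *m Pc1.
Definition Y2 (Jhat ghat : 'M[R]_(N.+2 * N.+2)) :=
  Pc2^T *m Hhat *m Jhat *m ghat *m Pc2.

Definition B11 J1 g1 Jhat ghat (alpha : R) := X1 J1 g1 - alpha *: Y1 Jhat ghat.
Definition B22 J2 g2 Jhat ghat (beta : R) := X2 J2 g2 - beta *: Y2 Jhat ghat.
End Grid.
End Matrices.

(* Main.v *)
(** Let [X] be positive definite and [Y] symmetric, and let [t0] be the infimum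
    of all [t] such that [t X - Y] is positive semi-definite.  Then [t0 X - Y]
    is positive semi-definite; were it invertible, it would be coercive, so that
    [t] could be decreased below [t0].  Hence [t0 X - Y] is singular, that is,
    [t0] is a generalized eigenvalue, whence [t0 <= max lambda].  Finally
    [X - alpha Y = alpha (alpha^-1 X - Y)] with [max lambda <= alpha^-1]. *)

Require Import Defs.
From mathcomp Require Import all_boot all_order all_algebra.
From mathcomp Require Import reals.
From mathcomp Require Import classical_sets ring lra.
From mathcomp.real_closed Require Import mxtens.
Import Order.TTheory GRing.Theory Num.Theory.
Local Open Scope ring_scope.

Definition qform {R : realType} {n} (A : 'M[R]_n) (x : 'cV[R]_n) : R :=
  (x^T *m A *m x) 0 0.

Lemma qformB (R : realType) n (A B : 'M[R]_n) x :
  qform (A - B) x = qform A x - qform B x.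
Proof. by rewrite /qform mulmxBr mulmxBl !mxE. Qed.

Lemma qformZ (R : realType) n a (A : 'M[R]_n) x :
  qform (a *: A) x = a * qform A x.
Proof. by rewrite /qform -scalemxAr -scalemxAl mxE. Qed.

Lemma qformE (R : realType) n (A : 'M[R]_n) x :
  qform A x = \sum_i \sum_j A i j * (x i 0 * x j 0).
Proof.
rewrite /qform mxE exchange_big /=; apply: eq_bigr => j _.
rewrite mxE mulr_suml; apply: eq_bigr => i _; rewrite !mxE; ring.
Qed.

Lemma qform1E (R : realType) n (x : 'cV[R]_n) : qform 1%:M x = \sum_i x i 0 ^+ 2.
Proof. by rewrite /qform mulmx1 mxE; apply: eq_bigr => i _; rewrite mxE. Qed.

Lemma qform1_ge0 (R : realType) n (x : 'cV[R]_n) : 0 <= qform 1%:M x.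
Proof. by rewrite qform1E sumr_ge0 // => i _; rewrite sqr_ge0. Qed.

(** Each squared coordinate is at most the squared norm [qform 1%:M x], so by AM-GM every product
    [|x_i| |x_j|] is too. The extra [1] keeps the constant positive even for [A = 0]. *)
Lemma qform_ub (R : realType) n (A : 'M[R]_n) :
  exists2 C, 0 < C & forall x, qform A x <= C * qform 1%:M x.
Proof.
exists (1 + \sum_i \sum_j `|A i j|).
  by rewrite ltr_wpDr // sumr_ge0 // => i _; rewrite sumr_ge0.
move=> x; rewrite mulrDl mul1r ler_wpDl ?qform1_ge0 // qformE mulr_suml.
apply: ler_sum => i _; rewrite mulr_suml; apply: ler_sum => j _.
have coord k : `|x k 0| ^+ 2 <= qform 1%:M x.
  rewrite qform1E (bigD1 k) //= real_normK ?num_real // lerDl.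
  by rewrite sumr_ge0 // => l _; rewrite sqr_ge0.
apply: le_trans (ler_norm _) _; rewrite !normrM ler_wpM2l //.
have := coord i; have := coord j; have := sqr_ge0 (`|x i 0| - `|x j 0|); nra.
Qed.

(* Evaluate the form at [x - C^-1 A^-1 x], where [C] bounds the form of [A^-1]. *)
Lemma psd_unit_coercive (R : realType) n (A : 'M[R]_n) :
  possemidefmx A -> A \in unitmx ->
  exists2 c, 0 < c & forall x, c * qform 1%:M x <= qform A x.
Proof.
move=> [symA psdA] uA; have [C C0 hC] := qform_ub _ _ (invmx A).
exists C^-1 => [|x]; first by rewrite invr_gt0.
set y := invmx A *m x; have Ay : A *m y = x by rewrite mulKVmx.
have yA : y^T *m A = x^T by rewrite -[in LHS]symA -trmx_mul Ay.
(* Expansion of the form at [x - C^-1 *: y]: since [A y = x], the cross terms give the squared norm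
   of [x], and the form of [A] at [y] equals that of [invmx A] at [x]. *)
have -> : qform A x = qform A (x - C^-1 *: y) + 2 * C^-1 * qform 1%:M x
   - C^-1 ^+ 2 * qform (invmx A) x.
  have trB : (x - C^-1 *: y)^T = x^T - C^-1 *: y^T by rewrite linearB linearZ.
  rewrite /qform trB !mulmxBl !mulmxBr -!scalemxAl -!scalemxAr.
  rewrite yA -(mulmxA x^T A y) Ay mulmx1 -(mulmxA x^T (invmx A) x) -/y.
  rewrite !mxE; ring.
have := psdA (x - C^-1 *: y); rewrite -/(qform _ _) => h.
(* By the choice of [C], the negative term consumes at most half of the gain [2 * C^-1]. *)
have h2 : C^-1 ^+ 2 * qform (invmx A) x <= C^-1 * qform 1%:M x.
  have -> : C^-1 * qform 1%:M x = C^-1 ^+ 2 * (C * qform 1%:M x).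
    by field; rewrite gt_eqF.
  by rewrite ler_wpM2l ?sqr_ge0.
lra.
Qed.

Lemma posdef_psd (R : realType) n (A : 'M[R]_n) : posdefmx A -> possemidefmx A.
Proof.
case=> symA pdA; split=> // x; have [->|/pdA/ltW//] := eqVneq x 0.
by rewrite mulmx0 mxE.
Qed.

Lemma nonunit_ker (R : realType) n (A : 'M[R]_n) :
  A \notin unitmx -> exists2 x : 'cV[R]_n, x != 0 & A *m x = 0.
Proof.
rewrite -unitmx_tr -row_free_unit -kermx_eq0 => /rowV0Pn[v /sub_kermxP vA v0].
exists v^T; first by rewrite trmx_eq0.
by rewrite -[A]trmxK -trmx_mul vA trmx0.
Qed.

Lemma posdef_unit (R : realType) n (A : 'M[R]_n) : posdefmx A -> A \in unitmx.
Proof.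
case=> _ pdA; apply: contraT => /nonunit_ker[x /pdA + Ax0].
by rewrite -mulmxA Ax0 mulmx0 mxE ltxx.
Qed.

Lemma max_gen_eigenvalue_psd (R : realType) n (Y X : 'M[R]_n) l :
  posdefmx X -> Y^T = Y -> max_gen_eigenvalue Y X l ->
  possemidefmx (l *: X - Y).
Proof.
move=> pdX symY [[y y0 Yy] lmax]; have psdX := posdef_psd _ _ _ pdX.
have sym t : (t *: X - Y)^T = t *: X - Y.
  by rewrite linearB linearZ /= pdX.1 symY.
have [c c0 Xge] := psd_unit_coercive _ _ _ psdX (posdef_unit _ _ _ pdX).
have [C C0 Xle] := qform_ub _ _ X; have [D D0 Yle] := qform_ub _ _ Y.
pose E := [set t : R | forall x, 0 <= qform (t *: X - Y) x]%classic.
have E0 : (E !=set0)%classic.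
  (* The form of [Y] is at most [D] times the squared norm, and that of [X] at least [c] times
     it. *)
  exists (D / c) => x; rewrite qformB qformZ subr_ge0.
  apply: le_trans (Yle x) _; rewrite mulrAC ler_pdivlMr // -mulrA.
  by rewrite ler_pM2l // mulrC Xge.
(* At the eigenvector [y] the form of [t *: X - Y] is [(t - l) * qform X y], which forces
   [l <= t]. *)
have Elb : lbound E l.
  move=> t /(_ y); rewrite qformB qformZ subr_ge0.
  have -> : qform Y y = l * qform X y.
    by rewrite /qform -mulmxA Yy -scalemxAr mxE mulmxA.
  by rewrite ler_pM2r //; exact: pdX.2.
have Ehlb : has_lbound E by exists l.
have psd0 : possemidefmx (inf E *: X - Y).
  split=> // x; have [->|x0] := eqVneq x 0; first by rewrite mulmx0 mxE.
  rewrite -/(qform _ _) qformB qformZ subr_ge0.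
  have X0 : 0 < qform X x by exact: pdX.2.
  (* For fixed [x] the Rayleigh quotient of [Y] over [X] is a lower bound of [E], hence at most
     [inf E]. *)
  rewrite -ler_pdivrMr //; apply: lb_le_inf => // t /(_ x).
  by rewrite qformB qformZ subr_ge0 ler_pdivrMr.
have sing : inf E *: X - Y \notin unitmx.
  apply/negP => /(psd_unit_coercive _ _ _ psd0)[d d0 hd].
  (* Lowering [t] by [d / C] costs at most [d] times the squared norm, which coercivity affords. *)
  have : E (inf E - d / C).
    move=> x; rewrite scalerBl addrAC qformB qformZ subr_ge0.
    apply: le_trans (hd x); rewrite mulrAC ler_pdivrMr // -mulrA.
    by rewrite ler_pM2l // mulrC Xle.
  move/(ge_inf Ehlb); rewrite lerBrDr gerDl leNgt divr_gt0 //.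
have -> : l = inf E; last by [].
(* [l] bounds [E] from below; conversely, a kernel vector of the singular matrix makes [inf E] an
   eigenvalue. *)
apply/eqP; rewrite eq_le lb_le_inf //=; apply: lmax.
have [x x0 /eqP] := nonunit_ker _ _ _ sing.
by rewrite mulmxBl subr_eq0 -scalemxAl => /eqP XY; exists x.
Qed.

Lemma psd_sub_scale_inv_max_gen_eigenvalue (R : realType) n (Y X : 'M[R]_n) l a :
  posdefmx X -> Y^T = Y -> max_gen_eigenvalue Y X l ->
  0 < a -> a <= 1 / l -> possemidefmx (X - a *: Y).
Proof.
move=> pdX symY hl a0; rewrite div1r => al.
split=> [|x]; first by rewrite linearB linearZ /= pdX.1 symY.
(* Positivity of [a] excludes [l = 0], whose inverse is [0] by convention, as well as negative
   [l]. *)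
have l0 : 0 < l by rewrite -invr_gt0 (lt_le_trans a0).
have := (max_gen_eigenvalue_psd _ _ _ _ _ pdX symY hl).2 x.
have := (posdef_psd _ _ _ pdX).2 x.
rewrite -!/(qform _ _) !qformB !qformZ !subr_ge0 => X0 YX.
(* The form of [Y] is at most [l] times that of [X], and [a * l <= 1]. *)
apply: le_trans (_ : a * (l * qform X x) <= _); first by rewrite ler_pM2l.
by rewrite mulrA ler_piMl // -ler_pdivlMr // div1r.
Qed.

Lemma pos_diag_mxP (R : realType) n (A : 'M[R]_n) :
  pos_diag_mx A <-> exists2 d : 'rV_n, A = diag_mx d & forall i, 0 < d 0 i.
Proof.
split=> [[/diag_mxP[d ->] pd]|[d -> pd]].
  by exists d => // i; have := pd i; rewrite mxE eqxx mulr1n.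
by split=> [|i]; [exact: diag_mx_is_diag | rewrite mxE eqxx mulr1n].
Qed.

Lemma pos_diag_mxM (R : realType) n (A B : 'M[R]_n) :
  pos_diag_mx A -> pos_diag_mx B -> pos_diag_mx (A *m B).
Proof.
move=> /pos_diag_mxP[a -> a0] /pos_diag_mxP[b -> b0].
apply/pos_diag_mxP; rewrite mulmx_diag; eexists; first by [].
by move=> i; rewrite mxE mulr_gt0.
Qed.

Lemma pos_diag_tensmx (R : realType) m n (A : 'M[R]_m) (B : 'M[R]_n) :
  pos_diag_mx A -> pos_diag_mx B -> pos_diag_mx (A *t B).
Proof.
move=> /pos_diag_mxP[a -> a0] /pos_diag_mxP[b -> b0]; split.
  apply/is_diag_mxP => i j.
  case: (mxtens_indexP i) => i1 i2; case: (mxtens_indexP j) => j1 j2.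
  rewrite tensmxE !mxE; case: (eqVneq i1 j1) => [->|_ _]; last by rewrite mul0r.
  by case: (eqVneq i2 j2) => [->|_ _]; [rewrite eqxx | rewrite mulr0].
move=> i; case: (mxtens_indexP i) => i1 i2.
by rewrite tensmxE !mxE !eqxx !mulr1n mulr_gt0.
Qed.

Lemma pos_diag_sym (R : realType) n (A : 'M[R]_n) : pos_diag_mx A -> A^T = A.
Proof. by case/pos_diag_mxP => d -> _; rewrite tr_diag_mx. Qed.

Lemma pos_diag_posdef (R : realType) n (A : 'M[R]_n) :
  pos_diag_mx A -> posdefmx A.
Proof.
move=> pdA; split=> [|x x0]; first exact: pos_diag_sym.
case/pos_diag_mxP: pdA => d -> d0; have [i xi] : exists i, x i 0 != 0.
  apply/existsP; apply: contraNT x0 => /existsPn x0.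
  by apply/eqP/colP => i; rewrite mxE; apply/eqP; rewrite -[_ == _]negbK x0.
(* The form is a weighted sum of squares; the nonzero coordinate [i] makes it strictly positive. *)
rewrite mxE (bigD1 i) //= mul_mx_diag !mxE.
apply: ltr_pwDl.
  by rewrite mulrAC -expr2 mulr_gt0 // exprn_even_gt0.
apply: sumr_ge0 => j _; rewrite !mxE mulrAC -expr2.
by rewrite mulr_ge0 ?sqr_ge0 // ltW.
Qed.

(** The form at the [i]-th basis vector is the entry [A i i]. *)
Lemma posdef_pos_diag (R : realType) n (A : 'M[R]_n) :
  is_diag_mx A -> posdefmx A -> pos_diag_mx A.
Proof.
move=> dA [_ pdA]; split=> // i.
have := pdA (delta_mx i 0); rewrite trmx_delta -rowE -colE !mxE; apply.
by apply/eqP => /colP/(_ i)/eqP; rewrite !mxE !eqxx oner_eq0.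
Qed.

Lemma congr_mx_sym (R : realType) m n (A : 'M[R]_(m, n)) (D : 'M[R]_m) :
  D^T = D -> (A^T *m D *m A)^T = A^T *m D *m A.
Proof. by move=> sD; rewrite !trmx_mul trmxK sD mulmxA. Qed.

Theorem lemma3 (R : realType) (N : nat) (hN : (1 <= N)%N)
  (M : 'M[R]_(N.+1)) (Mhat : 'M[R]_(N.+2))
  (P : 'M[R]_(N.+1, N.+2)) (Phat : 'M[R]_(N.+2, N.+1))
  (hsbp : staggered_sbp M Mhat P Phat)
  (J1 g1_11 : 'M[R]_(N.+1 * N.+2)) (J2 g2_22 : 'M[R]_(N.+2 * N.+1))
  (Jhat ghat11 ghat22 : 'M[R]_(N.+2 * N.+2))
  (hJ1 : pos_diag_mx J1) (hg1 : pos_diag_mx g1_11)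
  (hJ2 : pos_diag_mx J2) (hg2 : pos_diag_mx g2_22)
  (hJhat : pos_diag_mx Jhat)
  (hghat11 : pos_diag_mx ghat11) (hghat22 : pos_diag_mx ghat22)
  (alpha beta : R) (halpha : 0 < alpha) (hbeta : 0 < beta)
  (maxl1 maxl2 : R)
  (hmaxl1 : max_gen_eigenvalue (Y1 Mhat Phat Jhat ghat11)
                               (X1 M Mhat J1 g1_11) maxl1)
  (hmaxl2 : max_gen_eigenvalue (Y2 Mhat Phat Jhat ghat22)
                               (X2 M Mhat J2 g2_22) maxl2)
  (hale : alpha <= 1 / maxl1) (hble : beta <= 1 / maxl2) :
  possemidefmx (B11 M Mhat Phat J1 g1_11 Jhat ghat11 alpha) /\
  possemidefmx (B22 M Mhat Phat J2 g2_22 Jhat ghat22 beta).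
Proof.
case: hsbp => -[dM pM] [dMh pMh] _ _ _.
have {dM pM}hM := posdef_pos_diag _ _ _ dM pM.
have {dMh pMh}hMh := posdef_pos_diag _ _ _ dMh pMh.
have hH : pos_diag_mx (Hhat Mhat) by exact: pos_diag_tensmx.
split.
- apply: psd_sub_scale_inv_max_gen_eigenvalue hmaxl1 halpha hale.
    apply: pos_diag_posdef; apply: pos_diag_mxM hg1; apply: pos_diag_mxM hJ1.
    exact: pos_diag_tensmx.
  (* Reassociation exhibits [Y1] as a congruence of the diagonal matrix [Hhat *m Jhat *m ghat11]. *)
  rewrite /Y1 -2!(mulmxA _^T); apply: congr_mx_sym; apply: pos_diag_sym.
  exact: pos_diag_mxM (pos_diag_mxM _ _ _ _ hH hJhat) hghat11.
- apply: psd_sub_scale_inv_max_gen_eigenvalue hmaxl2 hbeta hble.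
    apply: pos_diag_posdef; apply: pos_diag_mxM hg2; apply: pos_diag_mxM hJ2.
    exact: pos_diag_tensmx.
  rewrite /Y2 -2!(mulmxA _^T); apply: congr_mx_sym; apply: pos_diag_sym.
  exact: pos_diag_mxM (pos_diag_mxM _ _ _ _ hH hJhat) hghat22.
Qed.
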